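(* Let $a,d$ be positive integers with $\gcd(a,d)=1$. Suppose that $d\ge 3$ and $a+d\ge 4d^3$. Let $\mu$, $j$, $\alpha_1,\ldots,\alpha_{n+1}$ be the integers attached to $(a,d)$ as defined in the context, and let $h(a,d,1)=\left(a-\left((\mu-1)d+\alpha_{j+1}\right)\right)^2$. Then the largest perfect square not belonging to $\langle a,a+d\rangle$ is $$ {}^{2}r(\langle a,a+d\rangle)=h(a,d,1). $$
   Context: For positive integers $s_1,\dots,s_n$, $\langle s_1,\dots,s_n\rangle=\{\sum_i x_is_i : x_i \text{ integers},\ x_i\ge 0\}$. For a numerical semigroup $S$ with $1\notin S$ (generated by relatively prime positive integers), ${}^{2}r(S)$ denotes the largest perfect square $m^2$ ($m\ge 1$ an integer) not belonging to $S$. For relatively prime positive integers $a,d$ and any integer $i$, $\lambda_i$ is the unique integer in $\{0,1,\ldots,d-1\}$ such that $\lambda_i a+i^2\equiv 0 \pmod d$. Put $\lambda^*=\max_{0\le i\le d-1}\lambda_i$. Let $\alpha_1<\cdots<\alpha_n$ be all the elements $\alpha$ of $\{0,1,\ldots,d-1\}$ with $\lambda_\alpha=\lambda^*$, and put $\alpha_{n+1}=d+\alpha_1$. Let $j\in\{1,\ldots,n\}$ be the (unique) index and $\mu\ge 0$ the (unique) integer such that $$(\mu d+\alpha_j)^2\le (d-\lambda^* )(a+d)<(\mu d+\alpha_{j+1})^2 .$$ *)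

(* Defs.v *)
From mathcomp Require Import all_boot all_order all_algebra ring.

Set Implicit Arguments.
Unset Strict Implicit.
Unset Printing Implicit Defensive.

Definition semigroup (s : seq nat) : nat -> Prop :=
  fun m => exists x : 'I_(size s) -> nat,
    m = \sum_(i < size s) x i * nth 0 s i.

(* [square_frobenius S r] reads "2r(S) = r"; r is unique when it exists. *)
Definition square_frobenius (S : nat -> Prop) (r : nat) : Prop :=
  [/\ exists2 m, 0 < m & r = m ^ 2,
      ~ S r
    & forall m, 0 < m -> ~ S (m ^ 2) -> m ^ 2 <= r].

(* Since [iota 0 d] starts at 0, the index returned by [find] is the least l
   satisfying the test. When a and d are coprime and d > 0, exactly one l < d
   does ([lambdaP]); the junk value d occurs only otherwise. *)
Definition lambda (a d : nat) (i : int) : nat :=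
  find (fun l : nat => (d%:Z %| l%:Z * a%:Z + i ^+ 2)%Z%R) (iota 0 d).

Definition lambda_max (a d : nat) : nat := \max_(i < d) lambda a d i%:Z.

Definition alphas (a d : nat) : seq nat :=
  [seq i <- iota 0 d | lambda a d i%:Z == lambda_max a d].

(* Indexed from 1: [alpha a d k] is alpha_k for 1 <= k <= n and d + alpha_1
   for k = n + 1, where n = size (alphas a d). *)
Definition alpha (a d k : nat) : nat :=
  nth 0 (rcons (alphas a d) (d + head 0 (alphas a d))) k.-1.

(* The subtraction is in Z, as mu - 1 may be -1. The absolute value is
   harmless under the square and makes the result a natural number. *)
Definition h1 (a d mu j : nat) : nat :=
  absz (a%:Z - ((mu%:Z - 1) * d%:Z + (alpha a d j.+1)%:Z))%R ^ 2.

Import Order.TTheory GRing.Theory Num.Theory.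

Lemma lambda_uniq (a d : nat) (i : int) (l l' : nat) : coprime a d ->
  l < d -> l' < d -> (d%:Z %| l%:Z * a%:Z + i ^+ 2)%Z%R ->
  (d%:Z %| l'%:Z * a%:Z + i ^+ 2)%Z%R -> l = l'.
Proof.
move=> cad ld l'd dl dl'.
have : (d%:Z %| (l%:Z - l'%:Z) * a%:Z)%Z%R.
  have -> : ((l%:Z - l'%:Z) * a%:Z =
     (l%:Z * a%:Z + i ^+ 2) - (l'%:Z * a%:Z + i ^+ 2))%R.
    by rewrite mulrBl opprD addrACA subrr addr0.
  exact: rpredB.
rewrite Gauss_dvdzl; last by rewrite coprimezE /= coprime_sym.
by rewrite -eqz_mod_dvd !modz_nat eqz_nat !modn_small // => /eqP.
Qed.

Lemma lambdaP (a d : nat) (i : int) (l : nat) : 0 < d -> coprime a d ->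
  l = lambda a d i <-> l < d /\ (d%:Z %| l%:Z * a%:Z + i ^+ 2)%Z%R.
Proof.
move=> d_gt0 cad.
have [k kd dk] : exists2 k : nat,
    k < d & (d%:Z %| k%:Z * a%:Z + i ^+ 2)%Z%R.
  have [u [v uv]] := Bezoutz a%:Z d%:Z.
  have uv1 : (u * a%:Z + v * d%:Z = 1)%R.
    by rewrite uv /gcdz /= (eqP cad).
  pose z := (- (u * i ^+ 2))%R.
  have dn0 : (d%:Z != 0)%R by rewrite -lt0n.
  have z_ge0 := modz_ge0 z dn0.
  have z_lt : (modz z d%:Z < d%:Z)%R by apply: ltz_pmod.
  exists (absz (modz z d%:Z)); first by rewrite -ltz_nat gez0_abs.
  rewrite gez0_abs // /modz; set q := divz _ _.
  have -> : ((z - q * d%:Z) * a%:Z + i ^+ 2 = (v * i ^+ 2 - q * a%:Z) * d%:Z +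
     i ^+ 2 * (1 - (u * a%:Z + v * d%:Z)))%R by rewrite /z; ring.
  rewrite uv1 subrr mulr0 addr0.
  exact: dvdz_mull.
pose P (l : nat) := (d%:Z %| l%:Z * a%:Z + i ^+ 2)%Z%R.
have hasP : has P (iota 0 d) by apply/hasP; exists k; rewrite ?mem_iota.
have ld : lambda a d i < d by rewrite -[X in _ < X](size_iota 0) -has_find.
have dl : P (lambda a d i) by have := nth_find 0 hasP; rewrite nth_iota.
split=> [-> // | [ld' dl']].
exact: lambda_uniq cad _ _ dl' dl.
Qed.

(* Main.v *)
Require Import Defs.
From mathcomp Require Import all_boot all_order all_algebra.
From mathcomp Require Import zify.

Set Implicit Arguments.
Unset Strict Implicit.
Unset Printing Implicit Defensive.

Import GRing.Theory Num.Theory.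

(** Write B = a + d and let the squares be (B - p)^2. If d divides l a + p^2
    (that is, l = lambda_p), put K = (l B + p^2) / d and
    k = (l a + (p - d)^2) / d. Then
      (B - p)^2 = (B - K) a + k B,
    with k >= 0 ([square_expansion]). All other expansions of (B - p)^2 shift
    the two coefficients by multiples of B and - a. Hence the square lies in
    <a, B> as soon as K <= B, i.e. p^2 <= (d - l) B ([semigroup_square_in]).
    If K > B and k < a, it does not: making the first coefficient nonnegative
    makes the second one negative ([semigroup_square_notin]). Squares of
    numbers at least B are beyond the conductor ([semigroup2_conductor]).

    It remains to find the least p >= 0 with p^2 > (d - lambda_p) B. Put
    c = d - lambda_max. The residues with lambda_p = lambda_max give the
    strictest bound, p^2 <= c B. Among such p, the last one satisfying it is
    Y = mu d + alpha_j and the first one violating it is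
    P = mu d + alpha_{j+1} ([alpha_consecutive]). For other residues the bound
    is p^2 <= (c + 1) B or weaker. It holds for all p < P, because P <= Y + d
    and B >= 4 d^3 leaves room for (Y + d)^2 <= Y^2 + B ([square_gap_le]).
    So all squares above (B - P)^2 are in the semigroup.

    That (B - P)^2 is not in it also needs k < a, i.e. (P - d)^2 < c a. As
    P - d is close to Y and Y^2 may be as large as c (a + d), this
    fails to follow from P - d <= Y; it needs P - d <= Y - 1
    ([threshold_shift_lt]). So consecutive alphas must be less than d apart,
    which means that lambda takes its maximum at two residues at least
    ([alphas_not_constant]). *)

(** * Two-generator semigroups *)

Lemma semigroup2P (a b m : nat) :
  semigroup [:: a; b] m <-> exists x y, m = x * a + y * b.
Proof.
split=> [[x ->]|[x [y ->]]].
  by exists (x ord0), (x (lift ord0 ord0)); rewrite big_ord_recl big_ord1.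
exists (fun i => if i == ord0 then x else y).
by rewrite big_ord_recl big_ord1.
Qed.

(** The multiplier of b can be chosen below a by solving a congruence modulo
    a; the remainder is then a nonnegative multiple of a. *)
Lemma semigroup2_conductor (a b m : nat) :
  0 < a -> coprime a b -> a * b <= m -> semigroup [:: a; b] m.
Proof.
move=> a_gt0 cab le_m; apply/semigroup2P.
have [b0|b_gt0] := posnP b.
  move: cab; rewrite b0 /coprime gcdn0 => /eqP ->.
  by exists m, 0; rewrite muln1 muln0 addn0.
case: (egcdnP b a_gt0) => u v; rewrite (eqP cab) => uv _.
have av : a %| v * b + 1 by rewrite -uv dvdn_mull.
(* As v b = -1 modulo a, v (a - 1) is an inverse of b modulo a. *)
pose y := (v * (a - 1) * m) %% a.
have lt_y : y < a by rewrite ltn_mod.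
have le_yb : y * b <= m.
  by apply: leq_trans le_m; rewrite leq_mul2r (ltnW lt_y) orbT.
have ya : y * b = m %[mod a].
  rewrite modnMml; apply/eqP.
  rewrite -(eqn_modDr (v * b * m)).
  have -> : v * (a - 1) * m * b + v * b * m = v * b * m * a.
    by case: a a_gt0 {uv av y lt_y le_yb cab le_m} => // a _; nia.
  have -> : m + v * b * m = m * (v * b + 1) by nia.
  by rewrite modnMl eq_sym; apply: dvdn_mull.
have /dvdnP[x xE] : a %| m - y * b by rewrite -eqn_mod_dvd // ya.
by exists x, y; rewrite -xE subnK.
Qed.

(** * Squares in <a, a + d> *)

(** k is nonnegative because k d is a sum of nonnegative terms. Working with
    the product k d also avoids a division, and K may exceed a + d, so that
    the identity is over the integers. *)
Lemma square_expansion (a d l p : nat) : 0 < d -> d %| l * a + p ^ 2 ->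
  exists K k : nat, [/\ K * d = l * (a + d) + p ^ 2,
    (k%:Z * d%:Z = l%:Z * a%:Z + (p%:Z - d%:Z) ^+ 2)%R
  & ((a%:Z + d%:Z - p%:Z) ^+ 2 =
      (a%:Z + d%:Z - K%:Z) * a%:Z + k%:Z * (a%:Z + d%:Z))%R].
Proof.
move=> d_gt0 dv.
have /dvdnP[K KE] : d %| l * (a + d) + p ^ 2.
  by rewrite mulnDr addnAC dvdn_addl // dvdn_mull.
pose k : int := (K%:Z + d%:Z - 2 * p%:Z - l%:Z)%R.
have KEz : (K%:Z * d%:Z = l%:Z * (a%:Z + d%:Z) + p%:Z ^+ 2)%R by lia.
have kE : (k * d%:Z = l%:Z * a%:Z + (p%:Z - d%:Z) ^+ 2)%R by rewrite /k; lia.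
have k_ge0 : (0 <= k)%R.
  rewrite -(@pmulr_lge0 _ d%:Z) // kE.
  by rewrite addr_ge0 ?sqr_ge0 ?mulr_ge0.
exists K, (absz k); rewrite gez0_abs //; split=> //.
rewrite /k; lia.
Qed.

(** The last hypothesis says exactly that the coefficient a + d - K of
    [square_expansion] is nonnegative. *)
Lemma semigroup_square_in (a d l p : nat) : 0 < d -> d %| l * a + p ^ 2 ->
  p <= a + d -> p ^ 2 + l * (a + d) <= d * (a + d) ->
  semigroup [:: a; a + d] ((a + d - p) ^ 2).
Proof.
move=> d_gt0 dv le_p le_sq; apply/semigroup2P.
have [K [k [KE _ E]]] := square_expansion d_gt0 dv.
have le_K : K <= a + d by rewrite -(leq_pmul2r d_gt0) KE; lia.
exists (a + d - K), k.
have [m mE] : exists m, a + d - p = m by exists (a + d - p).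
have [x xE] : exists x, a + d - K = x by exists (a + d - K).
rewrite mE xE; move: E.
have -> : (a%:Z + d%:Z - p%:Z)%R = m%:Z%R by lia.
have -> : (a%:Z + d%:Z - K%:Z)%R = x%:Z%R by lia.
lia.
Qed.

(** The last two hypotheses say that the coefficients a + d - K and k of
    [square_expansion] satisfy a + d - K < 0 and k < a. Any other expansion
    x a + y (a + d) has k - y divisible by a; nonnegativity of x would force
    0 <= y < k, whence 0 < k - y < a. *)
Lemma semigroup_square_notin (a d l p : nat) : 0 < d -> coprime a d ->
  d %| l * a + p ^ 2 -> d <= p <= a + d ->
  d * (a + d) < p ^ 2 + l * (a + d) -> (p - d) ^ 2 + l * a < d * a ->
  ~ semigroup [:: a; a + d] ((a + d - p) ^ 2).
Proof.
move=> d_gt0 cad dv /andP[le_dp le_p] lt_sq lt_sq' /semigroup2P[x [y E]].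
have [K [k [KE kE rep]]] := square_expansion d_gt0 dv.
have lt_K : a + d < K by rewrite -(ltn_pmul2r d_gt0) KE; lia.
have lt_k : k < a.
  rewrite -(ltn_pmul2r d_gt0).
  have [i iE] : exists i, p - d = i by exists (p - d).
  move: lt_sq' kE; rewrite iE.
  have -> : (p%:Z - d%:Z)%R = i%:Z%R by lia.
  lia.
have E2 : (x + (K - (a + d))) * a + y * (a + d) = k * (a + d).
  have [m mE] : exists m, a + d - p = m by exists (a + d - p).
  have [z zE] : exists z, K - (a + d) = z by exists (K - (a + d)).
  move: E rep; rewrite mE zE.
  have -> : (a%:Z + d%:Z - p%:Z)%R = m%:Z%R by lia.
  have -> : (a%:Z + d%:Z - K%:Z)%R = (- z%:Z)%R by lia.
  lia.
have lt_y : y < k.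
  rewrite -(@ltn_pmul2r (a + d)) ?addn_gt0 ?d_gt0 ?orbT // -E2.
  rewrite -[X in X < _]add0n ltn_add2r muln_gt0 addn_gt0 subn_gt0 lt_K orbT.
  by rewrite (leq_ltn_trans _ lt_k).
have : a %| (k - y) * (a + d).
  by rewrite mulnBl -E2 addnK dvdn_mull.
rewrite Gauss_dvdl; last by rewrite /coprime gcdnDl.
by move/dvdn_leq; lia.
Qed.

(** * The function lambda and its maximum *)

Lemma lambda_nat_spec (a d i : nat) : 0 < d -> coprime a d ->
  lambda a d i%:Z < d /\ d %| lambda a d i%:Z * a + i ^ 2.
Proof.
move=> d_gt0 cad.
have [lt_d] := (lambdaP i%:Z (lambda a d i%:Z) d_gt0 cad).1 erefl.
set l := lambda _ _ _ in lt_d *.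
have -> : (l%:Z * a%:Z + i%:Z ^+ 2)%R = (l * a + i ^ 2)%:Z%R by lia.
by [].
Qed.

Lemma lambda_nat_eq (a d i l : nat) : 0 < d -> coprime a d ->
  l < d -> d %| l * a + i ^ 2 -> lambda a d i%:Z = l.
Proof.
move=> d_gt0 cad lt_l dv; apply/esym/(lambdaP _ _ d_gt0 cad); split; first exact: lt_l.
have -> : (l%:Z * a%:Z + i%:Z ^+ 2)%R = (l * a + i ^ 2)%:Z%R by lia.
by [].
Qed.

Lemma lambda_mod (a d i : nat) : 0 < d -> coprime a d ->
  lambda a d (i %% d)%N%:Z = lambda a d i%:Z.
Proof.
move=> d_gt0 cad; have [lt_d dv] := lambda_nat_spec i d_gt0 cad.
apply: lambda_nat_eq => //.
by rewrite /dvdn -modnDmr modnXm modnDmr.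
Qed.

Lemma lambda_opp (a d i : nat) : 0 < d -> coprime a d -> i <= d ->
  lambda a d (d - i)%N%:Z = lambda a d i%:Z.
Proof.
move=> d_gt0 cad le_i; have [lt_d dv] := lambda_nat_spec i d_gt0 cad.
apply: lambda_nat_eq => //; set l := lambda _ _ _ in dv *.
rewrite -(dvdn_addl _ (dvdn_mulr (2 * i) (dvdnn d))).
have -> : l * a + (d - i) ^ 2 + d * (2 * i) = l * a + i ^ 2 + d * d.
  rewrite -addnA (_ : (d - i) ^ 2 + d * (2 * i) = i ^ 2 + d * d) ?addnA //.
  by rewrite -{2 3 4}(subnK le_i); lia.
by rewrite dvdn_addl // dvdn_mulr.
Qed.

Lemma leq_lambda_max (a d i : nat) : 0 < d -> coprime a d ->
  lambda a d i%:Z <= lambda_max a d.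
Proof.
move=> d_gt0 cad; rewrite -lambda_mod //.
exact: (leq_bigmax (Ordinal (ltn_pmod i d_gt0))).
Qed.

Lemma mem_alphas (a d i : nat) :
  (i \in alphas a d) = (lambda a d i%:Z == lambda_max a d) && (i < d).
Proof. by rewrite mem_filter mem_iota. Qed.

Lemma alphas_neq_nil (a d : nat) : 0 < d -> exists i, i \in alphas a d.
Proof.
move=> d_gt0; have [|i iE] := @bigop.eq_bigmax 'I_d (fun i => lambda a d i%:Z).
  by rewrite card_ord.
by exists (i : nat); rewrite mem_alphas /lambda_max iE eqxx ltn_ord.
Qed.

Lemma lambda_max_lt (a d : nat) : 0 < d -> coprime a d -> lambda_max a d < d.
Proof.
move=> d_gt0 cad; have [i] := alphas_neq_nil a d_gt0.
by rewrite mem_alphas => /andP[/eqP <- _]; case: (lambda_nat_spec i d_gt0 cad).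
Qed.

Lemma lambda_max_gt0 (a d : nat) : 1 < d -> coprime a d -> 0 < lambda_max a d.
Proof.
move=> d_gt1 cad; have d_gt0 := ltnW d_gt1.
apply: leq_trans (leq_lambda_max 1 d_gt0 cad).
rewrite lt0n; apply/eqP => l0.
have [_] := lambda_nat_spec 1 d_gt0 cad.
by rewrite l0 mul0n add0n exp1n dvdn1 gtn_eqF.
Qed.

(** Suppose that i is the only maximiser. As lambda_i = lambda_{d-i} and
    lambda_0 = 0 is not maximal, i = d - i, so d = 2 i. Then 2 i^2 = 0 modulo d
    forces 2 lambda_max = 0 modulo d, so lambda_max = i. Expanding (i + 1)^2
    gives lambda_{i+1} = lambda_1 + lambda_max modulo d. For d > 2, the
    residues 1 and i + 1 differ from i, so both lambda_1 and lambda_{i+1} are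
    less than lambda_max = d / 2; then lambda_1 + lambda_max - lambda_{i+1}
    is a multiple of d strictly between 0 and d. *)
Lemma alphas_not_constant (a d i : nat) : 2 < d -> coprime a d ->
  i \in alphas a d -> exists2 i', i' \in alphas a d & i' != i.
Proof.
move=> d_gt2 cad i_al.
have d_gt0 : 0 < d by lia.
have lM_lt := lambda_max_lt d_gt0 cad.
have lM_gt0 : 0 < lambda_max a d by apply: lambda_max_gt0 => //; lia.
have [li lt_i] : lambda a d i%:Z = lambda_max a d /\ i < d.
  by move: i_al; rewrite mem_alphas => /andP[/eqP].
have [_ dvi] := lambda_nat_spec i d_gt0 cad.
have i_gt0 : 0 < i.
  rewrite lt0n; apply/eqP => i0; move: li; rewrite i0.
  by rewrite (@lambda_nat_eq _ _ _ 0) // => l0; rewrite -l0 in lM_gt0.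
have [iE|] := eqVneq (d - i) i; last first.
  by exists (d - i); rewrite // mem_alphas lambda_opp ?li ?eqxx //; lia.
have dE : d = 2 * i by lia.
have [eq1|neq1] := eqVneq (lambda a d 1%:Z) (lambda_max a d).
  by exists 1; rewrite ?mem_alphas ?eq1 ?eqxx //; lia.
have [eq2|neq2] := eqVneq (lambda a d i.+1%:Z) (lambda_max a d).
  by exists i.+1; rewrite ?mem_alphas ?eq2 ?eqxx //; lia.
have lt1 : lambda a d 1%:Z < lambda_max a d.
  by rewrite ltn_neqAle neq1 leq_lambda_max.
have lt2 : lambda a d i.+1%:Z < lambda_max a d.
  by rewrite ltn_neqAle neq2 leq_lambda_max.
have [_ dv1] := lambda_nat_spec 1 d_gt0 cad.
have [_ dv2] := lambda_nat_spec i.+1 d_gt0 cad.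
rewrite li in dvi; move: dv1 dv2 dvi lt1 lt2 lM_lt lM_gt0.
set l1 := lambda a d 1%:Z; set l2 := lambda a d i.+1%:Z.
set lM := lambda_max a d => dv1 dv2 dvi lt1 lt2 lM_lt lM_gt0.
have cda : coprime d a by rewrite coprime_sym.
have lM_half : lM = i.
  have : d %| 2 * lM.
    rewrite -(Gauss_dvdl _ cda).
    have := dvdn_mull 2 dvi; rewrite mulnDr mulnA dvdn_addl //.
    by rewrite expnS expn1 mulnA -dE dvdn_mulr.
  by case/dvdnP=> -[|[|q]]; lia.
have dv3 : d %| l1 + lM - l2.
  rewrite -(Gauss_dvdl _ cda) mulnBl.
  have dv : d %| (l1 + lM) * a + i.+1 ^ 2.
    have -> : (l1 + lM) * a + i.+1 ^ 2 =
      (l1 * a + 1 ^ 2) + (lM * a + i ^ 2) + 2 * i by lia.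
    by rewrite -dE dvdn_addl // dvdn_addl.
  by have := dvdn_sub dv dv2; rewrite subnDr.
by have := @dvdn_leq d (l1 + lM - l2) _ dv3; lia.
Qed.

(** * Consecutive maximisers *)

Lemma sorted_alphas (a d : nat) : sorted ltn (alphas a d).
Proof. exact: (sorted_filter ltn_trans _ (iota_ltn_sorted 0 d)). Qed.

Lemma alphas_nth_leq (a d i j : nat) : i <= j < size (alphas a d) ->
  nth 0 (alphas a d) i <= nth 0 (alphas a d) j.
Proof.
case/andP=> le_ij lt_j; have := sorted_alphas a d.
rewrite ltn_sorted_uniq_leq => /andP[_ srt].
apply: (sorted_leq_nth leq_trans leqnn 0 srt) => //.
exact: leq_ltn_trans lt_j.
Qed.

Lemma alphaE (a d j : nat) : 1 <= j <= size (alphas a d) ->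
  alpha a d j = nth 0 (alphas a d) j.-1.
Proof. by case: j => // j /andP[_ lt_j]; rewrite /alpha nth_rcons /= lt_j. Qed.

Lemma alpha_lastE (a d : nat) :
  alpha a d (size (alphas a d)).+1 = d + nth 0 (alphas a d) 0.
Proof. by rewrite /alpha nth_rcons ltnn eqxx nth0. Qed.

Lemma alpha_mem (a d j : nat) : 1 <= j <= size (alphas a d) ->
  alpha a d j \in alphas a d.
Proof.
by move=> j_range; rewrite alphaE // mem_nth //; case: j j_range.
Qed.

Lemma alphaS_mod_mem (a d j : nat) : 1 <= j <= size (alphas a d) ->
  alpha a d j.+1 %% d \in alphas a d.
Proof.
case/andP=> j_gt0; rewrite leq_eqVlt => /predU1P[jE | lt_j].
  have al0 : nth 0 (alphas a d) 0 \in alphas a d by rewrite mem_nth // -jE.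
  have := al0; rewrite jE alpha_lastE modnDl mem_alphas => /andP[_ lt_d].
  by rewrite modn_small.
have al : alpha a d j.+1 \in alphas a d by exact: alpha_mem.
by have := al; rewrite mem_alphas => /andP[_ lt_d]; rewrite modn_small.
Qed.

(** Only the gap from alpha_n to d + alpha_1 could be as large as d, which
    happens exactly when n = 1. *)
Lemma alphaS_lt (a d j : nat) : 2 < d -> coprime a d ->
  1 <= j <= size (alphas a d) -> alpha a d j.+1 < alpha a d j + d.
Proof.
move=> d_gt2 cad j_range; have /andP[j_gt0] := j_range.
rewrite leq_eqVlt => /predU1P[jE | lt_j]; last first.
  have : alpha a d j.+1 \in alphas a d by exact: alpha_mem.
  by rewrite mem_alphas => /andP[_] /leq_trans; apply; rewrite leq_addl.
rewrite {1}jE alpha_lastE addnC ltn_add2r.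
have [i i_al i_neq] := alphas_not_constant d_gt2 cad (alpha_mem j_range).
have lt_i : index i (alphas a d) < size (alphas a d) by rewrite index_mem.
have le0 := @alphas_nth_leq a d 0 (index i (alphas a d)) lt_i.
have le_j : nth 0 (alphas a d) (index i (alphas a d)) <= alpha a d j.
  by rewrite alphaE //; apply: alphas_nth_leq; lia.
rewrite nth_index // in le0 le_j.
lia.
Qed.

(** mu d + alpha_j and mu d + alpha_{j+1} are successive terms of the
    increasing sequence of all maximisers of lambda among the natural numbers:
    the comparison is on quotients by d first, then on residues. *)
Lemma alpha_consecutive (a d j mu q : nat) : 0 < d -> coprime a d ->
  1 <= j <= size (alphas a d) -> lambda a d q%:Z = lambda_max a d ->
  q < mu * d + alpha a d j.+1 -> q <= mu * d + alpha a d j.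
Proof.
move=> d_gt0 cad j_range lq lt_q.
have r_al : q %% d \in alphas a d.
  by rewrite mem_alphas lambda_mod // lq eqxx ltn_pmod.
have lt_r := ltn_pmod q d_gt0.
move: lt_q; rewrite [q](divn_eq q d).
set r := q %% d in r_al lt_r *; set t := q %/ d.
have lt_i : index r (alphas a d) < size (alphas a d) by rewrite index_mem.
have rE := nth_index 0 r_al.
have [lt_t|gt_t|->] := ltngtP t mu.
- have : t.+1 * d <= mu * d by rewrite leq_mul2r lt_t orbT.
  lia.
- have le_r := @alphas_nth_leq a d 0 (index r (alphas a d)) lt_i.
  rewrite rE in le_r.
  have : mu.+1 * d <= t * d by rewrite leq_mul2r gt_t orbT.
  have /andP[j_gt0] := j_range.
  rewrite leq_eqVlt => /predU1P[jE | lt_j].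
    by rewrite {1}jE alpha_lastE; lia.
  have : alpha a d j.+1 \in alphas a d by exact: alpha_mem.
  by rewrite mem_alphas; lia.
rewrite ltn_add2l leq_add2l (alphaE j_range) -rE.
have [le_i _|gt_i] := leqP (index r (alphas a d)) j.-1.
  by apply: alphas_nth_leq; rewrite le_i; lia.
rewrite alphaE; last by lia.
rewrite ltnNge => /negP[]; rewrite [j.+1.-1]/=.
by apply: alphas_nth_leq; rewrite lt_i andbT; lia.
Qed.

(** * Estimates *)

(** The conclusion is (Y + d)^2 <= Y^2 + B. With Y^2 <= (d - 1) B it
    amounts to 2 d sqrt ((d - 1) B) + d^2 <= B, and at B = 4 d^3 this is
    4 d^2 sqrt (d (d - 1)) + d^2 <= 4 d^3, true as
    sqrt (d (d - 1)) <= d - 1 / 2. The factor d - 1 instead of d is what pays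
    for the term d^2. *)
Lemma square_gap_le (d B Y : nat) : 4 * d ^ 3 <= B -> Y ^ 2 <= d.-1 * B ->
  2 * d * Y + d ^ 2 <= B.
Proof.
case: d => [|d] /= B_ge Y_le; first by rewrite !mul0n.
rewrite leqNgt; apply/negP => lt_B.
(* Squaring W < 2 d Y, with W = B - d^2, avoids the square root. *)
have [W WE] : exists W, B = W + d.+1 ^ 2 by exists (B - d.+1 ^ 2); nia.
have lt_W : W < 2 * d.+1 * Y by lia.
have : W ^ 2 < (2 * d.+1 * Y) ^ 2 by rewrite ltn_exp2r.
have : 4 * d.+1 ^ 2 * Y ^ 2 <= 4 * d.+1 ^ 2 * (d * B).
  by rewrite leq_mul2l Y_le orbT.
have : W * (4 * d.+1 ^ 3) <= W * (W + d.+1 ^ 2).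
  by rewrite leq_mul2l -WE B_ge orbT.
have : d.+1 ^ 2 * (4 * d.+1 ^ 3) <= d.+1 ^ 2 * (W + d.+1 ^ 2).
  by rewrite leq_mul2l -WE B_ge orbT.
have := leq0n (d.+1 ^ 2 * W); have := leq0n (d.+1 ^ 4).
rewrite WE; lia.
Qed.

(** Since P - d <= Y - 1, it suffices that (Y - 1)^2 < Y^2 - c d, that is
    c d < 2 Y - 1. This holds because P^2 > c B >= 4 c d^3 >= (2 c d)^2 gives
    P > 2 c d, and Y > P - d. *)
Lemma threshold_shift_lt (c d a Y P : nat) : 0 < c < d ->
  4 * d ^ 3 <= a + d -> Y ^ 2 <= c * (a + d) < P ^ 2 -> P < Y + d ->
  d <= P /\ (P - d) ^ 2 < c * a.
Proof.
case/andP=> c_gt0 lt_c B_ge /andP[Y_le P_gt] lt_P.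
have P_ge : 2 * c * d < P.
  rewrite -(@ltn_exp2r _ _ 2) //; apply: leq_ltn_trans P_gt.
  apply: (@leq_trans (c * (4 * d ^ 3))); last by rewrite leq_mul2l B_ge orbT.
  have -> : (2 * c * d) ^ 2 = c * (c * (4 * d ^ 2)) by lia.
  have -> : 4 * d ^ 3 = d * (4 * d ^ 2) by lia.
  by rewrite leq_mul2l leq_mul2r (ltnW lt_c) !orbT.
have cd : d <= c * d by rewrite leq_pmull.
split; first by lia.
have [i iE] : exists i, P = i + d by exists (P - d); lia.
rewrite iE addnK.
have : i.+1 ^ 2 <= Y ^ 2 by rewrite leq_exp2r //; lia.
lia.
Qed.

(** * The largest square outside the semigroup *)

Theorem corollary2p9 (a d : nat) (a_gt0 : 0 < a) (d_gt0 : 0 < d)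
    (coprime_ad : coprime a d) (d_ge3 : 3 <= d) (ad_ge : 4 * d ^ 3 <= a + d)
    (mu j : nat) (j_range : 1 <= j <= size (alphas a d))
    (mu_j : (mu * d + alpha a d j) ^ 2
              <= (d - lambda_max a d) * (a + d)
              < (mu * d + alpha a d j.+1) ^ 2) :
  square_frobenius (semigroup [:: a; a + d]) (h1 a d mu j).
Proof.
have lM_lt := lambda_max_lt d_gt0 coprime_ad.
have lM_gt0 : 0 < lambda_max a d by apply: lambda_max_gt0 => //; lia.
have lt_gap := alphaS_lt d_ge3 coprime_ad j_range.
have consec q := @alpha_consecutive a d j mu q d_gt0 coprime_ad j_range.
have lP : lambda a d (mu * d + alpha a d j.+1)%N%:Z = lambda_max a d.
  have := alphaS_mod_mem j_range; rewrite mem_alphas => /andP[/eqP <- _].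
  by rewrite -lambda_mod // modnMDl.
rewrite /h1; move: mu_j consec lP.
set Y := _ + alpha a d j; set P := _ + alpha a d j.+1 => mu_j consec lP.
have lt_P : P < Y + d by rewrite /Y /P -addnA ltn_add2l.
set lM := lambda_max a d in lM_lt lM_gt0 mu_j lP consec.
have [c [cE c_gt0 lt_c]] : exists c, [/\ d - lM = c, 0 < c & c < d].
  by exists (d - lM); split=> //; lia.
rewrite cE in mu_j; have /andP[Y_le P_gt] := mu_j.
have dE x : d * x = c * x + lM * x by rewrite -mulnDl; congr (_ * x); lia.
have [|le_dP lt_Pd] := @threshold_shift_lt c d a Y P _ ad_ge mu_j lt_P.
  by rewrite c_gt0.
have gapY : 2 * d * Y + d ^ 2 <= a + d.
  apply: square_gap_le => //; apply: leq_trans Y_le _.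
  by rewrite leq_mul2r; apply/orP; right; lia.
have sq_le p : p < Y + d -> p ^ 2 <= c.+1 * (a + d).
  move=> /ltnW lt_p; have : p ^ 2 <= (Y + d) ^ 2 by rewrite leq_exp2r.
  rewrite sqrnD; lia.
have lt_PB : P < a + d.
  rewrite -(@ltn_exp2r _ _ 2) //; apply: leq_ltn_trans (sq_le _ lt_P) _.
  apply: (@leq_ltn_trans (d * (a + d))); first by rewrite leq_mul2r lt_c orbT.
  by rewrite expnS expn1 ltn_mul2r; lia.
have -> : absz (a%:Z - ((mu%:Z - 1) * d%:Z + (alpha a d j.+1)%:Z))%R = a + d - P.
  by rewrite /P in lt_PB *; lia.
have [_ dvP] := lambda_nat_spec P d_gt0 coprime_ad; rewrite lP in dvP.
split; first by exists (a + d - P); rewrite ?subn_gt0.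
  apply: (@semigroup_square_notin a d lM P) => //.
  - by rewrite le_dP ltnW.
  - by rewrite dE ltn_add2r.
  by rewrite dE ltn_add2r.
move=> m m_gt0 nSm; rewrite leq_exp2r // leqNgt; apply/negP => lt_m; apply: nSm.
have [le_m|lt_mB] := leqP (a + d) m.
  apply: semigroup2_conductor => //; first by rewrite /coprime gcdnDl.
  by rewrite expnS expn1 leq_mul //; lia.
have [p pE] : exists p, m = a + d - p.
  by exists (a + d - m); rewrite subKn // ltnW.
have lt_p : p < P by lia.
have [_ dvp] := lambda_nat_spec p d_gt0 coprime_ad.
rewrite pE; apply: semigroup_square_in dvp _ _ => //; first by lia.
(* Either p is a maximiser, hence at most Y, or the bound for p is weaker
   than the extremal one by at least a + d. *)
have := leq_lambda_max p d_gt0 coprime_ad.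
rewrite leq_eqVlt => /predU1P[lp | lt_l].
  have le_pY := consec p lp lt_p.
  rewrite lp dE leq_add2r; apply: leq_trans Y_le.
  by rewrite leq_exp2r.
have : p ^ 2 <= c.+1 * (a + d) by apply: sq_le; lia.
have : (lambda a d p%:Z).+1 * (a + d) <= lM * (a + d).
  by rewrite leq_mul2r lt_l orbT.
rewrite dE; lia.
Qed.
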